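(* Consider the dispersion process on a sufficiently long path (of length large in terms of $M$, e.g. at least $12M\log M$) with $M$ particles initially placed at the central vertex. For any $\varepsilon>0$, with high probability (as $M\to\infty$), $\lfloor M/2\rfloor \le \mathbf D_{\text{Disp}}\le 4(1+\varepsilon)M\log M$ and $\mathbf T_{\text{Disp}}=O(M^3\log M)$.
   Context: The dispersion process: $M$ particles start at one origin vertex; synchronously at each step, at each vertex occupied by more than one particle at the start of the step, each of these particles moves independently to a uniformly random neighbour; a particle alone at a vertex does not move. The process terminates at the first step where every vertex holds at most one particle. $\mathbf T_{\text{Disp}}$ is the number of steps until termination, and $\mathbf D_{\text{Disp}}$ is the maximum graph distance of any particle from the origin at termination. *)

(* Defs.v *)
From HB Require Import structures.
From mathcomp Require Import all_boot all_order all_algebra.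
From mathcomp Require Import all_classical all_reals all_analysis.

Set Implicit Arguments.
Unset Strict Implicit.
Unset Printing Implicit Defensive.

Import Order.TTheory GRing.Theory Num.Theory.

Local Open Scope ring_scope.

Section Graph.
Variables (V : finType) (e : rel V).

Definition degree (u : V) : nat := #|[pred v | e u v]|.

(* The least length of a walk from [u] to [v]; a shortest walk has fewer than
   [#|V|] edges, and the value is [#|V|] when no walk exists. *)
Definition gdist (u v : V) : nat :=
  find (fun k => [exists p : k.-tuple V, path e u p && (last u p == v)])
       (iota 0 #|V|).

End Graph.

Definition path_graph (n : nat) : rel 'I_n :=
  fun i j => (i.+1 == j :> nat) || (j.+1 == i :> nat).

(* The unique middle vertex when [n] is odd, either of the two when [n] is
   even. *)
Definition central (n : nat) (o : 'I_n) : bool :=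
  (o == (n.-1)./2 :> nat) || (o == n./2 :> nat).

Section Dispersion.
Variables (V : finType) (e : rel V) (M : nat).

Definition config := {ffun 'I_M -> V}.

Definition occupancy (x : config) (v : V) : nat := #|[pred i | x i == v]|.

Definition dispersed (x : config) : bool := [forall v, (occupancy x v <= 1)%N].

Definition move_prob (R : realType) (x : config) (i : 'I_M) (v : V) : R :=
  if (1 < occupancy x (x i))%N then (e (x i) v)%:R / (degree e (x i))%:R
  else (v == x i)%:R.

(* The product over the particles expresses that, given [x], they move
   independently of each other. *)
Definition step_prob (R : realType) (x y : config) : R :=
  \prod_(i < M) move_prob R x i (y i).

(* [X t w i] is the position of particle [i] after [t] steps.  The last clause
   says that, conditionally on the whole history [X 0, ..., X t], the law of
   [X t.+1] is [step_prob R (X t)]; it is written without division so that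
   histories of probability zero need no exception. *)
Definition dispersion_process (R : realType) (o : V) (d : measure_display)
    (Omega : measurableType d) (P : probability Omega R)
    (X : nat -> Omega -> config) : Prop :=
  [/\ forall t x, measurable [set w | X t w = x]%classic,
      P [set w | X 0%N w = [ffun=> o]]%classic = 1%E
    & forall t (x : nat -> config),
        P [set w | forall s, (s <= t.+1)%N -> X s w = x s]%classic =
        (P [set w | forall s, (s <= t)%N -> X s w = x s]%classic
          * (step_prob R (x t) (x t.+1))%:E)%E ].

(* [None] when the trajectory never becomes dispersed. *)
Definition T_Disp (x : nat -> config) : option nat :=
  if pselect (exists t, dispersed (x t)) is left h then Some (ex_minn h)
  else None.

Definition D_Disp (o : V) (x : nat -> config) : option nat :=
  omap (fun t => \max_(i < M) gdist e o (x t i)) (T_Disp x).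

End Dispersion.

(* Main.v *)
(* The order of the particles is preserved across a gap of length at least two,
   and each end of such a gap either rests or, being occupied by at least two
   moving particles, moves inwards with probability at least 3/4.  Hence, up to
   a bounded error, [3 ^ length] is a supermartingale for every gap, and by time
   O(M^3 log M) no gap ever exceeds [4 log M] with high probability, because
   [3 ^ (4 log M)] is a power of [M] of exponent [4 ln 3 > 4].  As long as this
   holds all particles stay within [4 M log M] of the origin, away from the ends
   of the path.
   There, the sum [D] of the distances between particles drifts upwards at each
   step by at least the number [k] of moving particles, whereas one step changes
   it by at most [2 k M].  So [exp (- c D / M^3)] decreases geometrically in
   mean, while [D <= 4 M^3 log M] as long as the gaps are short: this forces
   dispersion after O(M^3 log M) steps.  The exponential, rather than the first
   moment and Markov's inequality, makes the constant independent of the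
   required probability. *)

Require Import Defs.
From HB Require Import structures.
From mathcomp Require Import all_boot all_order all_algebra.
From mathcomp Require Import all_classical all_reals all_analysis.
From mathcomp Require Import zify ring lra.

Set Implicit Arguments.
Unset Strict Implicit.
Unset Printing Implicit Defensive.

Import Order.TTheory GRing.Theory Num.Theory.

Local Open Scope classical_set_scope.
Local Open Scope ring_scope.

(** * Exit of a Markov chain from a set *)

Section MarkovExit.
Variables (R : realType) (d : measure_display) (Omega : measurableType d).
Variables (P : probability Omega R) (C : finType) (X : nat -> Omega -> C).
Hypothesis measX : forall t x, measurable [set w | X t w = x].

Let pr (A : set Omega) : R := fine (P A).

Let prE A : measurable A -> P A = (pr A)%:E.
Proof. by move=> mA; rewrite fineK// fin_num_measure. Qed.

Let pr_le A B : measurable A -> measurable B -> A `<=` B -> pr A <= pr B.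
Proof.
by move=> mA mB AB; rewrite -lee_fin -!prE//; apply: le_measure => //;
  rewrite inE.
Qed.

Lemma measurable_at t (Q : pred C) : measurable [set w | Q (X t w)].
Proof.
have -> : [set w | Q (X t w)] = \bigcup_(x in [set x | Q x]) [set w | X t w = x].
  apply/seteqP; split => w /=; first by move=> Qw; exists (X t w).
  by case=> x /= Qx ->.
by apply: fin_bigcup_measurable => // x _; exact: measX.
Qed.

Lemma measurable_history t (h : nat -> C) :
  measurable [set w | forall s, (s <= t)%N -> X s w = h s].
Proof.
have -> : [set w | forall s, (s <= t)%N -> X s w = h s] =
    \bigcap_(s in [set s | (s <= t)%N]) [set w | X s w = h s].
  by apply/seteqP; split => w /=.
by apply: bigcap_measurable => [|s _]; [exists 0%N | exact: measX].
Qed.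

Variables (S bad : pred C) (K : C -> C -> R).

(* During the times [0, ..., m], the trajectory [z] does not leave [S] or first
   leaves it at a point of [bad]. *)
Fixpoint no_good_exit (m : nat) (z : nat -> C) : bool :=
  if S (z 0%N) then
    if m is m'.+1 then no_good_exit m' (fun s => z s.+1) else true
  else bad (z 0%N).

Lemma good_exit m z : ~~ no_good_exit m z ->
  exists2 t, (t <= m)%N &
    [/\ forall s, (s < t)%N -> S (z s), ~~ S (z t) & ~~ bad (z t)].
Proof.
elim: m z => [|m IHm] z /=; case: ifPn => // Sz; try by exists 0%N.
move=> /IHm[t tm [Slt nS nb]]; exists t.+1 => //; split=> // -[//|s] st.
exact: Slt.
Qed.

Lemma measurable_no_good_exit m j :
  measurable [set w | no_good_exit m (fun s => X (j + s) w)].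
Proof.
elim: m j => [|m IHm] j /=.
  rewrite (_ : [set w | _] =
    [set w | [pred x | if S x then true else bad x] (X (j + 0)%N w)]) //.
  exact: measurable_at.
have -> : [set w | if S (X (j + 0)%N w) then
            no_good_exit m (fun s => X (j + s.+1)%N w) else bad (X (j + 0)%N w)] =
    ([set w | S (X (j + 0)%N w)] `&`
     [set w | no_good_exit m (fun s => X (j.+1 + s)%N w)]) `|`
    [set w | [pred x | ~~ S x && bad x] (X (j + 0)%N w)].
  have e w : (fun s => X (j + s.+1)%N w) = (fun s => X (j.+1 + s)%N w).
    by apply/funext => s; rewrite addSnnS.
  apply/seteqP; split => w /=; rewrite e; case: ifPn => //= ?; [by left|by right| |].
  - by case=> // -[].
  - by case=> // -[].
by apply: measurableU; [apply: measurableI => //|]; exact: measurable_at.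
Qed.

Hypothesis stepX : forall t (x : nat -> C),
  P [set w | forall s, (s <= t.+1)%N -> X s w = x s] =
  (P [set w | forall s, (s <= t)%N -> X s w = x s] * (K (x t) (x t.+1))%:E)%E.

(** The potential [f] pays for an exit into [bad], as in the maximal inequality for
    supermartingales; [g] pays for remaining in [S] throughout. *)
Variables (f g : C -> R) (c rho Lam gam : R).
Hypotheses (f_ge0 : forall x, 0 <= f x) (g_ge0 : forall x, 0 <= g x).
Hypotheses (c_ge0 : 0 <= c) (rho_ge0 : 0 <= rho).
Hypotheses (Lam_gt0 : 0 < Lam) (gam_gt0 : 0 < gam).
Hypothesis f_bad : forall x, bad x -> Lam <= f x.
Hypothesis g_S : forall x, S x -> gam <= g x.
Hypothesis K_sum : forall x, S x -> \sum_y K x y <= 1.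
Hypothesis f_super : forall x, S x -> \sum_y K x y * f y <= f x + c.
Hypothesis g_super : forall x, S x -> \sum_y K x y * g y <= rho * g x.

(* A supersolution of the backward equation satisfied by the probability of
   [no_good_exit m] starting from [x]. *)
Let F m x := (f x + c * m%:R) / Lam + rho ^+ m * g x / gam.

Let F_ge0 m x : 0 <= F m x.
Proof. by rewrite addr_ge0// divr_ge0 ?(ltW Lam_gt0, ltW gam_gt0)//
  ?addr_ge0 ?mulr_ge0 ?exprn_ge0. Qed.

Let F_bad m x : bad x -> 1 <= F m x.
Proof.
move=> bx; rewrite -[1]addr0 lerD//; last first.
  by rewrite divr_ge0 ?(ltW gam_gt0)// mulr_ge0// exprn_ge0.
rewrite ler_pdivlMr// mul1r; apply: le_trans (f_bad bx) _.
by rewrite lerDl mulr_ge0.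
Qed.

Let F_rec m x : S x -> \sum_y K x y * F m y <= F m.+1 x.
Proof.
move=> Sx.
have -> : \sum_y K x y * F m y = (\sum_y K x y * f y + c * m%:R * \sum_y K x y)
    / Lam + rho ^+ m * (\sum_y K x y * g y) / gam.
  rewrite !mulr_sumr -big_split /= !mulr_suml -big_split /=.
  by apply: eq_bigr => y _; rewrite /F; ring.
apply: lerD.
  rewrite ler_pM2r ?invr_gt0//; have := f_super Sx; have := K_sum Sx.
  move=> h1 h2; apply: le_trans (lerD h2 (ler_wpM2l (mulr_ge0 c_ge0 (ler0n _ m)) h1)) _.
  by rewrite -natr1; lra.
rewrite ler_pM2r ?invr_gt0// exprSr -mulrA.
by apply: ler_wpM2l; [rewrite exprn_ge0|exact: g_super].
Qed.

Let hist j (h : nat -> C) := [set w | forall s, (s <= j)%N -> X s w = h s].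

(** Induction on [m], for all starting times and histories at once. The Markov property [stepX]
    speaks of full histories, so the bound is multiplied by the probability of the history instead
    of conditioning on it; null histories need no separate case. *)
Let no_good_exit_history m j h :
  pr (hist j h `&` [set w | no_good_exit m (fun s => X (j + s) w)])
    <= pr (hist j h) * F m (h j).
Proof.
have mh i k : measurable (hist i k) by exact: measurable_history.
have mA n i k : measurable (hist i k `&`
    [set w | no_good_exit n (fun s => X (i + s) w)]).
  by apply: measurableI => //; exact: measurable_no_good_exit.
have pr_ge0 A : 0 <= pr A by rewrite fine_ge0.
have triv n i k : 1 <= F n (k i) -> pr (hist i k `&`
    [set w | no_good_exit n (fun s => X (i + s) w)]) <= pr (hist i k) * F n (k i).
  move=> F1; apply: le_trans (pr_le (mA _ _ _) (mh _ _) _) _; first exact: subIsetl.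
  by rewrite ler_peMr.
(* Outside [S] there are two cases: at a bad point [F] is at least 1, and at any other point the
   exit is a good one, so the event is empty. *)
have bad_case n i k : ~~ S (k i) -> pr (hist i k `&`
    [set w | no_good_exit n (fun s => X (i + s) w)]) <= pr (hist i k) * F n (k i).
  move=> nS; have [bk|nb] := boolP (bad (k i)); first exact/triv/F_bad.
  set B := _ `&` _; have -> : B = set0.
    apply/seteqP; split => // w [hw] /=; have := hw i (leqnn i).
    by case: n @B => [|n] _ /=; rewrite addn0 => ->; rewrite (negbTE nS) (negbTE nb).
  by rewrite {1}/pr measure0 mulr_ge0.
elim: m j h => [|m IHm] j h; case: (boolP (S (h j))) => [Sh|]; try exact: bad_case.
  apply: triv; rewrite /F mulr0 addr0 expr0 mul1r -[1]add0r lerD//.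
    by rewrite divr_ge0// ltW.
  by rewrite ler_pdivlMr// mul1r g_S.
(* [hz z] prolongs the history by the state [z] at time [j.+1]; its values at later times are never
   read. *)
pose hz (z : C) := fun s => if (s <= j)%N then h s else z.
have hzP z : pr (hist j.+1 (hz z)) = pr (hist j h) * K (h j) z.
  rewrite /pr stepX; rewrite /hz leqnn ltnn fineM//; last first.
    by rewrite fin_num_measure//; exact: (mh j (hz z)).
  congr (fine (P _) * _); apply/seteqP; split => w /= hw s sj.
    by rewrite hw// sj.
  by rewrite sj hw.
pose A z := hist j.+1 (hz z) `&`
  [set w | no_good_exit m (fun s => X (j.+1 + s)%N w)].
apply: (@le_trans _ _ (\sum_z pr (A z))).
  have le0 : hist j h `&` [set w | no_good_exit m.+1 (fun s => X (j + s)%N w)]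
      `<=` \big[setU/set0]_(i < #|C|) A (enum_val i).
    move=> w [hw] /=; rewrite addn0 hw// Sh => nw.
    rewrite (bigD1 (enum_rank (X j.+1 w)))//=; left; rewrite enum_rankK.
    split=> [s|]; rewrite /hz.
      rewrite leq_eqVlt => /orP[/eqP ->|]; first by rewrite ltnn.
      by rewrite ltnS => sj; rewrite sj hw.
    by move: nw; congr (is_true (no_good_exit m _)); apply/funext => s; rewrite addSnnS.
  rewrite (reindex (@enum_val C (fun=> true))); last first.
    by apply: onW_bij; exact: enum_val_bij.
  rewrite -lee_fin -prE; last exact: mA.
  have mB i : measurable (A (enum_val i)) by exact: mA.
  rewrite -sumEFin; apply: le_trans (le_measure _ _ _ le0) _; rewrite ?inE.
  - exact: mA.
  - exact: bigsetU_measurable.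
  under [X in (_ <= X)%E]eq_bigr do rewrite -prE//.
  (* Boole's inequality is applied to a family indexed by natural numbers: the states are numbered,
     and [B] is empty from [#|C|] on. *)
  pose B i := if insub i is Some k then A (enum_val (k : 'I_#|C|)) else set0.
  have BE (i : 'I_#|C|) : B i = A (enum_val i) by rewrite /B valK.
  have := @Boole_inequality _ _ _ P B #|C|.
  rewrite (eq_bigr (fun i : 'I_#|C| => A (enum_val i))) => [|i _]; last exact: BE.
  rewrite (eq_bigr (fun i : 'I_#|C| => P (A (enum_val i)))) => [|i _]; last by rewrite BE.
  by apply=> i _; rewrite /B; case: insubP => [k _ _|_].
apply: (@le_trans _ _ (\sum_z pr (hist j h) * (K (h j) z * F m z))).
  apply: ler_sum => z _; apply: le_trans (IHm _ _) _.
  by rewrite hzP /hz ltnn mulrA.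
by rewrite -mulr_sumr ler_wpM2l//; exact: F_rec.
Qed.

(** The history up to time 0 is the start [c0], of probability 1, so the history bound becomes
    [F m c0]. On this event either no good exit happens up to time [m] or [A] holds. *)
Lemma markov_exit (c0 : C) m (A : set Omega) : measurable A ->
  P [set w | X 0%N w = c0] = 1%E ->
  (forall w t, (t <= m)%N -> (forall s, (s < t)%N -> S (X s w)) ->
     ~~ S (X t w) -> ~~ bad (X t w) -> A w) ->
  ((1 - ((f c0 + c * m%:R) / Lam + rho ^+ m * g c0 / gam))%:E <= P A)%E.
Proof.
move=> mA P0 hA; rewrite prE// lee_fin lerBlDr.
have h0 : hist 0 (fun=> c0) = [set w | X 0%N w = c0].
  apply/seteqP; split => w /=; first by move=> h; exact: h.
  by move=> h s; rewrite leqn0 => /eqP ->.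
have := no_good_exit_history m 0 (fun=> c0).
rewrite h0 {2}/pr P0 /= mul1r; set B := _ `&` _ => hB.
have mB : measurable B.
  by apply: measurableI => //; exact: measurable_no_good_exit.
apply: le_trans _ (lerD (lexx _) hB).
rewrite -lee_fin EFinD -!prE// -P0.
apply: le_trans _ (measureU2 P mA mB).
apply: le_measure; rewrite ?inE//; first exact: measurableU.
move=> w /= Xw; case: (boolP (no_good_exit m (fun s => X s w))) => [?|]; first by right.
by move=> /good_exit[t tm [h1 h2 h3]]; left; exact: hA h1 h2 h3.
Qed.

End MarkovExit.

(** * Mean values after one step *)

Section StepExpectation.
Variables (R : realType) (V : finType) (e : rel V) (M : nat).
Implicit Types x y : config V M.

Definition moving x i := (1 < occupancy x (x i))%N.

Definition step_mean x (F : config V M -> R) : R :=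
  \sum_y step_prob e R x y * F y.

(** Independence of the particles, in the form of distributivity of a product over sums. *)
Lemma step_mean_prod x (F : 'I_M -> V -> R) :
  step_mean x (fun y => \prod_i F i (y i)) =
  \prod_i \sum_v move_prob e R x i v * F i v.
Proof.
rewrite bigA_distr_bigA; apply: eq_bigr => y _.
by rewrite /step_prob -big_split.
Qed.

Lemma step_meanD x F G :
  step_mean x (fun y => F y + G y) = step_mean x F + step_mean x G.
Proof. by rewrite -big_split; apply: eq_bigr => y _; rewrite mulrDr. Qed.

Lemma step_meanZ x a F : step_mean x (fun y => a * F y) = a * step_mean x F.
Proof. by rewrite mulr_sumr; apply: eq_bigr => y _; rewrite mulrCA. Qed.

Lemma eq_step_mean x F G : F =1 G -> step_mean x F = step_mean x G.
Proof. by move=> FG; apply: eq_bigr => y _; rewrite FG. Qed.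

Lemma step_mean_sum x (I : finType) (F : I -> config V M -> R) :
  step_mean x (fun y => \sum_i F i y) = \sum_i step_mean x (F i).
Proof.
by rewrite exchange_big; apply: eq_bigr => y _; rewrite mulr_sumr.
Qed.

Lemma move_prob_ge0 x i v : 0 <= move_prob e R x i v.
Proof. by rewrite /move_prob; case: ifP => _ //; rewrite divr_ge0. Qed.

Lemma step_prob_ge0 x y : 0 <= step_prob e R x y.
Proof. by apply: prodr_ge0 => i _; exact: move_prob_ge0. Qed.

Lemma step_prob_support x y i : step_prob e R x y != 0 ->
  if moving x i then e (x i) (y i) else y i == x i.
Proof.
rewrite /step_prob (bigD1 i)//= mulf_eq0 => /norP[+ _].
rewrite /move_prob /moving; case: ifP => _; last by case: (y i == x i) => //=; rewrite mulr0n eqxx.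
by case: (e (x i) (y i)) => //; rewrite mul0r eqxx.
Qed.

Lemma le_step_mean x F G :
  (forall y, step_prob e R x y != 0 -> F y <= G y) ->
  step_mean x F <= step_mean x G.
Proof.
move=> FG; apply: ler_sum => y _; have [->|h] := eqVneq (step_prob e R x y) 0.
  by rewrite !mul0r.
by rewrite ler_wpM2l ?step_prob_ge0// FG.
Qed.

Lemma sum_move_prob_static x i (F : V -> R) : ~~ moving x i ->
  \sum_v move_prob e R x i v * F v = F (x i).
Proof.
move=> /negbTE m; rewrite (bigD1 (x i))//= big1 => [|v /negbTE vx].
  by rewrite /move_prob [(_ < _)%N]m eqxx mul1r addr0.
by rewrite /move_prob [(_ < _)%N]m vx mul0r.
Qed.

End StepExpectation.

(** * One step of the process on a path, away from its ends *)

Section PathStep.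
Variables (R : realType) (n M : nat).
Local Notation e := (@path_graph n).
Implicit Types x y : config 'I_n M.

(** Every occupied vertex then has two neighbours, so that a moving particle makes a fair step of
    size one. *)
Definition off_boundary x := forall i, (0 < x i < n.-1)%N.

Lemma sum_move_prob_moving x i (F : nat -> R) :
  (0 < x i < n.-1)%N -> moving x i ->
  \sum_v move_prob e R x i v * F v = (F (x i).-1 + F (x i).+1) / 2.
Proof.
move=> /andP[x0 xn] m.
have hl : ((x i).-1 < n)%N by lia.
have hr : ((x i).+1 < n)%N by lia.
pose l := Ordinal hl; pose r := Ordinal hr.
have eE v : e (x i) v = (v == l) || (v == r).
  rewrite /path_graph -!val_eqE /=; move: (nat_of_ord (x i)) (nat_of_ord v) x0 => u w; lia.
have lr : l != r by rewrite -val_eqE /=; lia.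
have deg : degree e (x i) = 2%N.
  transitivity #|pred2 l r|; last by rewrite card2 lr.
  by apply: eq_card => v; rewrite !inE eE.
have mE v : move_prob e R x i v = ((v == l) || (v == r))%:R / 2.
  by rewrite /move_prob -/(moving x i) m deg eE.
rewrite (bigD1 l)//= (bigD1 r)//=; last by rewrite eq_sym.
rewrite big1 => [|v /andP[/negbTE vl /negbTE vr]]; last by rewrite mE vl vr !mul0r.
by rewrite !mE !eqxx orbT addr0 mulrDl /=; ring.
Qed.

Lemma move_prob_sum1 x i : off_boundary x -> \sum_v move_prob e R x i v = 1.
Proof.
move=> hx; under eq_bigr do rewrite -[move_prob _ _ _ _ _]mulr1.
have [m|m] := boolP (moving x i); last exact: sum_move_prob_static.
by rewrite (sum_move_prob_moving (fun=> 1) (hx i) m); lra.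
Qed.

Lemma step_mean_on x (A : {set 'I_M}) (F : 'I_M -> 'I_n -> R) : off_boundary x ->
  step_mean e x (fun y => \prod_(i in A) F i (y i)) =
  \prod_(i in A) \sum_v move_prob e R x i v * F i v.
Proof.
move=> hx; under eq_step_mean => y do rewrite big_mkcond.
rewrite (step_mean_prod e x (fun i v => if i \in A then F i v else 1)).
rewrite [RHS]big_mkcond; apply: eq_bigr => i _; case: ifP => // _.
rewrite -[RHS](move_prob_sum1 i hx).
by apply: eq_bigr => v _; rewrite mulr1.
Qed.

Lemma step_mean1 x c : off_boundary x -> step_mean e x (fun=> c) = c :> R.
Proof.
move=> hx; have := step_mean_on finset.set0 (fun _ _ => 1) hx.
rewrite [RHS]big_set0 => h; rewrite -[RHS]mul1r -h /step_mean -[LHS]mulr_suml.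
by congr (_ * c); apply: eq_bigr => y _; rewrite big_set0 mulr1.
Qed.

Lemma step_mean_at x i (F : 'I_n -> R) : off_boundary x ->
  step_mean e x (fun y => F (y i)) = \sum_v move_prob e R x i v * F v.
Proof.
move=> hx; have := step_mean_on (finset.set1 i) (fun _ => F) hx.
by rewrite big_set1 => <-; apply: eq_step_mean => y; rewrite big_set1.
Qed.

Lemma step_mean_at2 x i j (F G : 'I_n -> R) : off_boundary x -> i != j ->
  step_mean e x (fun y => F (y i) * G (y j)) =
  (\sum_v move_prob e R x i v * F v) * (\sum_v move_prob e R x j v * G v).
Proof.
move=> hx ij.
have := step_mean_on (finset.setU (finset.set1 i) (finset.set1 j))
  (fun k => if k == i then F else G) hx.
have dij : j \notin [set i]%SET by rewrite inE eq_sym.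
have E (f : 'I_M -> R) : \prod_(k in [set i; j]%SET) f k = f i * f j.
  by rewrite finset.setUC big_setU1 ?big_set1 1?mulrC// inE eq_sym.
rewrite E eqxx eq_sym (negbTE ij) => <-.
by apply: eq_step_mean => y; rewrite E eqxx eq_sym (negbTE ij).
Qed.

Lemma path_step_dist x y i : step_prob e R x y != 0 ->
  [/\ (y i <= x i + moving x i)%N, (x i <= y i + moving x i)%N
    & moving x i -> (y i != x i :> nat)].
Proof.
move=> /(step_prob_support i).
case: (moving x i) => [|/eqP ->]; last by split=> //; rewrite addn0.
rewrite /path_graph; move: (nat_of_ord (x i)) (nat_of_ord (y i)) => u v /= h.
by split; lia.
Qed.

End PathStep.

(** * Gaps between consecutive particles *)

Section Gaps.
Variables (n M : nat) (o : 'I_n).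
Implicit Types x y : config 'I_n M.

(* A motionless particle [None] is added at the origin, so that the gaps
   between consecutive particles cover the way from the origin to any
   particle. *)
Definition site x (j : option 'I_M) : nat := if j is Some i then x i else o.

Definition below x v := #|[pred j | (site x j <= v)%N]|.

(* The position of the [k]-th particle from the left, for [1 <= k <= M.+1]. *)
Definition kth x k := find (fun v => (k <= below x v)%N) (iota 0 n).

Definition gap x k := (kth x k.+1 - kth x k)%N.

Definition adjacent_config x y :=
  forall j, (site y j <= (site x j).+1)%N && (site x j <= (site y j).+1)%N.

Lemma below_mono x u v : (u <= v)%N -> (below x u <= below x v)%N.
Proof.
move=> uv; apply: subset_leq_card; apply/fintype.subsetP => j; rewrite !inE => h.
exact: leq_trans h uv.
Qed.

Lemma site_lt x j : (site x j < n)%N.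
Proof. by case: j => [i|] /=; exact: ltn_ord. Qed.

Lemma below_last x : below x n.-1 = M.+1.
Proof.
transitivity #|{: option 'I_M}|; last by rewrite card_option card_ord.
by apply: eq_card => j; rewrite !inE; have := site_lt x j; lia.
Qed.

Lemma has_kth x k : (k <= M.+1)%N ->
  has (fun v => (k <= below x v)%N) (iota 0 n).
Proof.
move=> kM; apply/hasP; exists n.-1; last by rewrite below_last.
by rewrite mem_iota; have := ltn_ord o; lia.
Qed.

(** A Galois connection between [kth] and [below], by which comparisons with [kth] become counts of
    particles. *)
Lemma kth_leq x k v : (k <= M.+1)%N -> (kth x k <= v)%N = (k <= below x v)%N.
Proof.
move=> kM; have hk := has_kth x kM.
have kn : (kth x k < n)%N by rewrite -[X in (_ < X)%N](size_iota 0) -has_find.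
apply/idP/idP => [kv|kv].
  apply: leq_trans (below_mono x kv).
  by have := nth_find 0%N hk; rewrite -/(kth x k) nth_iota.
rewrite leqNgt; apply/negP => vk.
have := before_find 0%N vk; rewrite nth_iota ?add0n ?kv//.
exact: ltn_trans vk kn.
Qed.

Lemma ltn_kth x k v : (k <= M.+1)%N -> (v < kth x k)%N = (below x v < k)%N.
Proof. by move=> kM; rewrite ltnNge kth_leq// ltnNge. Qed.

Lemma kth_leS x k : (k <= M)%N -> (kth x k <= kth x k.+1)%N.
Proof.
move=> kM; rewrite kth_leq ?leqW//; apply: ltnW.
by rewrite -kth_leq.
Qed.

(** If no site were at [kth x k], the counts at this vertex and at its predecessor would agree,
    against minimality. The index 0 is excluded because [kth x 0] is 0 wherever the particles
    are. *)
Lemma kth_attained x k : (0 < k <= M.+1)%N -> exists j, site x j = kth x k.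
Proof.
move=> /andP[k0 kM].
have [/existsP[j /eqP <-]|/existsPn h] :=
  boolP [exists j, site x j == kth x k]; first by exists j.
have : (k <= below x (kth x k))%N by rewrite -kth_leq.
have E : below x (kth x k) = #|[pred j | (site x j < kth x k)%N]|.
  apply: eq_card => j; rewrite !inE leq_eqVlt.
  by have := h j => /negbTE ->.
rewrite E; case: {E} (kth x k) (@ltn_kth x k (kth x k).-1 kM) => [_|v /=].
  rewrite (_ : #|_| = 0%N); first by lia.
  by apply: eq_card0 => j; rewrite !inE.
rewrite ltnSn => h1 h2; have : (below x v < k)%N by rewrite -h1.
rewrite ltnNge; case/negP; apply: leq_trans h2 _.
by apply: subset_leq_card; apply/fintype.subsetP => j; rewrite !inE.
Qed.

Lemma adjacent_config_sym x y : adjacent_config x y -> adjacent_config y x.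
Proof. by move=> h j; have := h j; rewrite andbC. Qed.

Lemma kth_close x y k : (k <= M.+1)%N -> adjacent_config x y ->
  (kth y k <= (kth x k).+1)%N.
Proof.
move=> kM xy; rewrite kth_leq//.
apply: (@leq_trans (below x (kth x k))); first by rewrite -kth_leq.
apply: subset_leq_card; apply/fintype.subsetP => j; rewrite !inE.
by have := xy j; lia.
Qed.

Lemma gap_close x y k : (k <= M)%N -> adjacent_config x y -> (gap y k <= gap x k + 2)%N.
Proof.
move=> kM xy; have := kth_close (leqW kM) (adjacent_config_sym xy).
have := @kth_close x y k.+1 kM xy; have := kth_leS x kM; rewrite /gap; lia.
Qed.

(** Put [q = kth y k] and suppose that [j] ends beyond [q]. The [k] sites that end at most at [q]
    differ from [j], and together with [j] they started at most at [q.+1]. These are [k.+1] sites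
    strictly left of the right end of the gap, which is impossible. *)
Lemma left_end_le x y k j : (k <= M)%N -> adjacent_config x y -> (2 <= gap x k)%N ->
  site x j = kth x k -> (site y j <= kth y k)%N.
Proof.
move=> kM xy g2 xj; rewrite leqNgt; apply/negP => lt.
have k1 : (k <= M.+1)%N by exact: leqW.
have h1 : (k <= below y (kth y k))%N by rewrite -kth_leq.
have h2 : (below x (kth y k).+1 < k.+1)%N.
  rewrite -ltn_kth//; have := xy j; rewrite /gap in g2; lia.
have := kth_close k1 (adjacent_config_sym xy) => h3.
move: h2; rewrite ltnS leqNgt; case/negP.
rewrite /below (cardD1 j) !inE xj h3 add1n ltnS; apply: leq_trans h1 _.
apply: subset_leq_card; apply/fintype.subsetP => i; rewrite !inE => yi.
apply/andP; split; last by have := xy i; lia.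
by apply: contraTneq yi => ->; rewrite -ltnNge.
Qed.

Lemma right_end_ge x y k j : (k <= M)%N -> adjacent_config x y -> (2 <= gap x k)%N ->
  site x j = kth x k.+1 -> (kth y k.+1 <= site y j)%N.
Proof.
move=> kM xy g2 xj; rewrite kth_leq//.
have k1 : (k <= M.+1)%N by exact: leqW.
have := xy j; rewrite xj => xyj; rewrite /gap in g2.
(* Since the gap has length at least two, [v] is not left of its left end, so [k] sites start at
   most at [v]. They end at most at [site y j], and [v < site x j] shows that [j] is not among
   them. *)
pose v := (minn (site y j) (kth x k.+1)).-1.
have h1 : (k <= below x v)%N by rewrite -kth_leq// /v; lia.
rewrite /below (cardD1 j) !inE leqnn add1n ltnS; apply: leq_trans h1 _.
apply: subset_leq_card; apply/fintype.subsetP => i; rewrite !inE => xi.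
have := xy i; rewrite /v in xi => xyi.
apply/andP; split; last by lia.
by apply/eqP => ij; move: xi; rewrite ij xj; lia.
Qed.

Lemma sum_gap x : (\sum_(k < M) gap x k.+1 = kth x M.+1 - kth x 1)%N.
Proof.
suff : forall m, (m <= M)%N ->
    (\sum_(k < m) gap x k.+1 = kth x m.+1 - kth x 1)%N /\
    (kth x 1 <= kth x m.+1)%N by case/(_ M (leqnn M)).
elim=> [|m IHm] mM; first by rewrite big_ord0 subnn.
have [E le] := IHm (ltnW mM); have := @kth_leS x m.+1 mM => le'.
by rewrite big_ord_recr /= E /gap; split; lia.
Qed.

Lemma site_sub_le x i j : (site x j - site x i <= \sum_(k < M) gap x k.+1)%N.
Proof.
rewrite sum_gap.
have h1 : (kth x 1 <= site x i)%N.
  by rewrite kth_leq//; apply/card_gt0P; exists i; rewrite inE.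
have h2 : (site x j <= kth x M.+1)%N.
  have : (M.+1 <= below x (kth x M.+1))%N by rewrite -kth_leq.
  rewrite /below => h; have : #|[pred i | (site x i <= kth x M.+1)%N]| = #|{: option 'I_M}|.
    by apply/eqP; rewrite eqn_leq max_card card_option card_ord h.
  by move=> /subset_cardP/(_ (subset_predT _))/(_ j); rewrite !inE.
lia.
Qed.

Lemma gap_origin k : (0 < k <= M)%N -> gap [ffun=> o] k = 0%N.
Proof.
move=> /andP[k0 kM]; apply/eqP; rewrite subn_eq0 kth_leq//.
have [j ej] := @kth_attained [ffun=> o] k ltac:(lia).
have so i : site [ffun=> o] i = o by case: i => //= i; rewrite ffunE.
rewrite -ej so (_ : below _ _ = M.+1) ?ltnS//.
transitivity #|{: option 'I_M}|; last by rewrite card_option card_ord.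
by apply: eq_card => i; rewrite !inE so leqnn.
Qed.

End Gaps.

(** * Drift of the gap potential *)

Section GapPotential.
Variables (R : realType) (n M : nat) (o : 'I_n).
Local Notation e := (@path_graph n).
Implicit Types x y : config 'I_n M.

Lemma step_adjacent x y : step_prob e R x y != 0 -> adjacent_config o x y.
Proof.
move=> sxy [i|] /=; last by rewrite leqnSn.
have [+ + _] := path_step_dist i sxy.
by move: (nat_of_ord (x i)) (nat_of_ord (y i)) => u v; case: (moving x i) => /=; lia.
Qed.

(** [A] and [B] stand for moving particles at the left and right ends of a gap. Either may be empty,
    which covers resting ends and the cross terms in the product of two end bounds. *)
Lemma step_mean_opposite x (A B : {set 'I_M}) : off_boundary x ->
  fintype.disjoint (mem A) (mem B) -> {in (A :|: B)%SET, forall i, moving x i} ->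
  step_mean e x (fun y => \prod_(i in A) (y i < x i)%N%:R *
                          \prod_(i in B) (x i < y i)%N%:R) =
    (1 / 2) ^+ #|A| * (1 / 2) ^+ #|B| :> R.
Proof.
move=> hx dAB mAB.
pose F i (v : 'I_n) : R := if i \in A then (v < x i)%N%:R else (x i < v)%N%:R.
have FE (G : 'I_M -> R) : \prod_(i in (A :|: B)%SET) G i =
    \prod_(i in A) G i * \prod_(i in B) G i.
  by rewrite -bigU//=; apply: eq_bigl => i; rewrite !inE.
have nA i : i \in B -> (i \in A) = false.
  by move=> iB; apply/negP => iA; rewrite (disjointFr dAB iA) in iB.
have := step_mean_on (A :|: B)%SET F hx.
have -> : \prod_(i in (A :|: B)%SET) (\sum_v move_prob e R x i v * F i v) =
    \prod_(i in (A :|: B)%SET) (1 / 2).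
  apply: eq_bigr => i iAB; have := hx i => /andP[x0 xn].
  pose G (v : nat) : R := if i \in A then (v < x i)%N%:R else (x i < v)%N%:R.
  rewrite (sum_move_prob_moving G (hx i) (mAB _ iAB)) /G; congr (_ / _).
  have [-> -> -> ->] : [/\ ((x i).-1 < x i)%N = true, ((x i).+1 < x i)%N = false,
    (x i < (x i).-1)%N = false & (x i < (x i).+1)%N = true] by split; lia.
  by case: ifP => _; rewrite ?addr0 ?add0r.
rewrite FE !prodr_const => <-; apply: eq_step_mean => y; rewrite FE.
congr (_ * _); apply: eq_bigr => i h; rewrite /F; first by rewrite h.
by rewrite (nA _ h).
Qed.

(* A lone extremal particle stays put; otherwise two extremal particles move,
   and with probability 1/4 both of them widen the gap by one, while else it
   shrinks by one. *)
Lemma left_end_bound x k : off_boundary x -> (0 < k <= M)%N ->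
  (2 <= gap o x k)%N ->
  exists (a b : R) (A : {set 'I_M}),
    [/\ 0 <= a, 0 <= b, {in A, forall i, moving x i /\ x i = kth o x k :> nat},
        a + b * (1 / 2) ^+ #|A| = 1
      & forall y, step_prob e R x y != 0 ->
        3 ^+ kth o x k <=
        3 ^+ kth o y k * (a + b * \prod_(i in A) (y i < x i)%N%:R)].
Proof.
move=> hx /andP[k0 kM] g2.
have [j xj] := @kth_attained n M o x k ltac:(lia).
have le3 (p q : nat) : (p <= q)%N -> 3 ^+ p <= 3 ^+ q :> R.
  by move=> pq; rewrite ler_weXn2l// ler1n.
have static : (forall y, step_prob e R x y != 0 -> site o y j = site o x j) ->
    exists (a b : R) (A : {set 'I_M}),
    [/\ 0 <= a, 0 <= b, {in A, forall i, moving x i /\ x i = kth o x k :> nat},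
        a + b * (1 / 2) ^+ #|A| = 1
      & forall y, step_prob e R x y != 0 ->
        3 ^+ kth o x k <=
        3 ^+ kth o y k * (a + b * \prod_(i in A) (y i < x i)%N%:R)].
  move=> st; exists (1 : R), (0 : R), finset.set0.
  split=> // [i|/=|y sxy]; rewrite ?inE ?mul0r ?addr0 ?mulr1//.
  apply: le3; rewrite -xj -(st y sxy).
  exact: (left_end_le kM (step_adjacent sxy) g2 xj).
case: j xj static => [i|] /= xj static; last exact: static.
have [m|m] := boolP (moving x i); last first.
  apply: static => y sxy; have := step_prob_support i sxy.
  by rewrite (negbTE m) => /eqP ->.
have [i1 /andP[i1i /eqP xi1]] : exists i1, (i1 != i) && (x i1 == x i).
  move: m; rewrite /moving /occupancy (cardD1 i) !inE eqxx.
  by rewrite add1n ltnS => /card_gt0P[i1]; rewrite !inE => h; exists i1.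
have m1 : moving x i1 by rewrite /moving xi1.
(* The factor is [1/3 + 8/3 = 3] when both particles step outwards, and [1/3] otherwise; its mean is
   [1/3 + 8/3 * 1/4 = 1]. *)
exists (1 / 3 : R), (8 / 3 : R), [set i; i1]%SET; split=> [||l||y sxy]; [lra|lra| | |].
- by rewrite !inE => /orP[] /eqP ->; rewrite ?xi1.
- by rewrite cards2 eq_sym i1i; lra.
have adj := step_adjacent sxy.
have hi := @left_end_le n M o x y k (Some i) kM adj g2 xj.
have hi1 := @left_end_le n M o x y k (Some i1) kM adj g2
  ltac:(by rewrite /= xi1).
have [a1 a2 /(_ m) a3] := path_step_dist i sxy.
have [b1 b2 /(_ m1) b3] := path_step_dist i1 sxy.
have E : \prod_(l in [set i; i1]%SET) (y l < x l)%N%:R =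
    ((y i < x i) && (y i1 < x i1))%N%:R :> R.
  rewrite finset.setUC big_setU1 ?big_set1 ?inE//= -natrM mulnC.
  by case: (y i < x i)%N; case: (y i1 < x i1)%N.
rewrite E; move: a1 a2 b1 b2; rewrite m m1 !addn1 => a1 a2 b1 b2.
rewrite /= in hi hi1; rewrite xi1 in b1 b2 b3 *.
case: andP => [[c1 c2]|c].
  apply: le_trans (le3 _ (kth o y k).+1 _) _.
    by rewrite -xj (leq_trans a2)// ltnS.
  by rewrite exprS /= mulr1n; have := exprn_ge0 (kth o y k) (ler0n R 3); lra.
suff : (kth o x k < kth o y k)%N.
  move=> /le3; by rewrite exprS /= mulr0n; lra.
rewrite -xj; suff [h|h] : ((x i < y i) \/ (x i < y i1))%N.
- exact: leq_trans h hi.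
- exact: leq_trans h hi1.
apply/orP; apply/negPn/negP; rewrite negb_or -!leqNgt => /andP[c1 c2]; apply: c.
by rewrite !ltn_neqAle a3 b3 c1 c2.
Qed.

(** Mirror image of [left_end_bound]. *)
Lemma right_end_bound x k : off_boundary x -> (0 < k <= M)%N ->
  (2 <= gap o x k)%N ->
  exists (a b : R) (A : {set 'I_M}),
    [/\ 0 <= a, 0 <= b,
        {in A, forall i, moving x i /\ x i = kth o x k.+1 :> nat},
        a + b * (1 / 2) ^+ #|A| = 1
      & forall y, step_prob e R x y != 0 ->
        3 ^+ kth o y k.+1 <=
        3 ^+ kth o x k.+1 * (a + b * \prod_(i in A) (x i < y i)%N%:R)].
Proof.
move=> hx /andP[k0 kM] g2.
have [j xj] := @kth_attained n M o x k.+1 ltac:(lia).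
have le3 (p q : nat) : (p <= q)%N -> 3 ^+ p <= 3 ^+ q :> R.
  by move=> pq; rewrite ler_weXn2l// ler1n.
have static : (forall y, step_prob e R x y != 0 -> site o y j = site o x j) ->
    exists (a b : R) (A : {set 'I_M}),
    [/\ 0 <= a, 0 <= b,
        {in A, forall i, moving x i /\ x i = kth o x k.+1 :> nat},
        a + b * (1 / 2) ^+ #|A| = 1
      & forall y, step_prob e R x y != 0 ->
        3 ^+ kth o y k.+1 <=
        3 ^+ kth o x k.+1 * (a + b * \prod_(i in A) (x i < y i)%N%:R)].
  move=> st; exists (1 : R), (0 : R), finset.set0.
  split=> // [i|/=|y sxy]; rewrite ?inE ?mul0r ?addr0 ?mulr1//.
  apply: le3; rewrite -xj -(st y sxy).
  exact: (right_end_ge kM (step_adjacent sxy) g2 xj).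
case: j xj static => [i|] /= xj static; last exact: static.
have [m|m] := boolP (moving x i); last first.
  apply: static => y sxy; have := step_prob_support i sxy.
  by rewrite (negbTE m) => /eqP ->.
have [i1 /andP[i1i /eqP xi1]] : exists i1, (i1 != i) && (x i1 == x i).
  move: m; rewrite /moving /occupancy (cardD1 i) !inE eqxx.
  by rewrite add1n ltnS => /card_gt0P[i1]; rewrite !inE => h; exists i1.
have m1 : moving x i1 by rewrite /moving xi1.
exists (1 / 3 : R), (8 / 3 : R), [set i; i1]%SET; split=> [||l||y sxy]; [lra|lra| | |].
- by rewrite !inE => /orP[] /eqP ->; rewrite ?xi1.
- by rewrite cards2 eq_sym i1i; lra.
have adj := step_adjacent sxy.
have hi := @right_end_ge n M o x y k (Some i) kM adj g2 xj.
have hi1 := @right_end_ge n M o x y k (Some i1) kM adj g2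
  ltac:(by rewrite /= xi1).
have [a1 a2 /(_ m) a3] := path_step_dist i sxy.
have [b1 b2 /(_ m1) b3] := path_step_dist i1 sxy.
have E : \prod_(l in [set i; i1]%SET) (x l < y l)%N%:R =
    ((x i < y i) && (x i1 < y i1))%N%:R :> R.
  rewrite finset.setUC big_setU1 ?big_set1 ?inE//= -natrM mulnC.
  by case: (x i < y i)%N; case: (x i1 < y i1)%N.
rewrite E; move: a1 a2 b1 b2; rewrite m m1 !addn1 => a1 a2 b1 b2.
rewrite /= in hi hi1; rewrite xi1 in b1 b2 b3 *.
case: andP => [[c1 c2]|c].
  apply: le_trans (le3 _ (kth o x k.+1).+1 _) _.
    by rewrite -xj (leq_trans hi).
  by rewrite exprS /= mulr1n; have := exprn_ge0 (kth o x k.+1) (ler0n R 3); lra.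
suff : (kth o y k.+1 < kth o x k.+1)%N.
  move=> /le3; by rewrite exprS /= mulr0n; lra.
rewrite -xj; suff [h|h] : ((y i < x i) \/ (y i1 < x i))%N.
- exact: leq_ltn_trans hi h.
- exact: leq_ltn_trans hi1 h.
apply/orP; apply/negPn/negP; rewrite negb_or -!leqNgt => /andP[c1 c2]; apply: c.
by split; rewrite ltn_neqAle eq_sym ?a3 ?b3 ?c1 ?c2.
Qed.

(** A gap shorter than two has length at most 3 after the step, whence [27 = 3 ^ 3]. For a longer
    gap the bounds for its two ends are multiplied; the moving particles at these ends are disjoint
    sets, so by independence the product of the two factors has mean 1. *)
Lemma gap_mean_le x k : off_boundary x -> (0 < k <= M)%N ->
  step_mean e x (fun y => 3 ^+ gap o y k) <= 3 ^+ gap o x k + 27 :> R.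
Proof.
move=> hx hk; have /andP[k0 kM] := hk.
have [g2|g2] := leqP 2 (gap o x k); last first.
  rewrite -[leRHS](step_mean1 _ hx); apply: le_step_mean => y sxy.
  rewrite -[leLHS]add0r lerD ?exprn_ge0//.
  have -> : 27 = 3 ^+ 3 :> R by ring.
  rewrite ler_weXn2l ?ler1n//.
  by have := gap_close kM (step_adjacent sxy); lia.
have [a [b [A [a0 b0 hA Aab hl]]]] := left_end_bound hx hk g2.
have [c [d [B [c0 d0 hB Bcd hr]]]] := right_end_bound hx hk g2.
have dAB : fintype.disjoint (mem A) (mem B).
  rewrite disjoint_subset; apply/fintype.subsetP => i iA; rewrite inE.
  apply/negP => iB; have [_ h1] := hA i iA; have [_ h2] := hB i iB.
  by move: g2; rewrite /gap -h1 -h2; lia.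
have mA : {in (A :|: finset.set0)%SET, forall i, moving x i}.
  by move=> i; rewrite finset.setU0 => /hA[].
have mB : {in (finset.set0 :|: B)%SET, forall i, moving x i}.
  by move=> i; rewrite finset.set0U => /hB[].
have mAB : {in (A :|: B)%SET, forall i, moving x i}.
  by move=> i; rewrite inE => /orP[/hA[]|/hB[]].
have m0 : {in (finset.set0 :|: finset.set0)%SET, forall i, moving x i}.
  by move=> i; rewrite !inE.
pose p (A' B' : {set 'I_M}) y : R := \prod_(i in A') (y i < x i)%N%:R *
  \prod_(i in B') (x i < y i)%N%:R.
apply: (@le_trans _ _ (3 ^+ gap o x k)); last by rewrite lerDl.
apply: (@le_trans _ _ (step_mean e x (fun y => 3 ^+ gap o x k *
    (a * c * p finset.set0 finset.set0 y + a * d * p finset.set0 B y +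
    (b * c * p A finset.set0 y + b * d * p A B y))))).
  apply: le_step_mean => y sxy; rewrite /p !big_set0.
  set u := \prod_(i in A) _; set v := \prod_(i in B) _.
  have u0 : 0 <= u by exact: prodr_ge0.
  have v0 : 0 <= v by exact: prodr_ge0.
  rewrite [X in _ <= _ * X](_ : _ = (a + b * u) * (c + d * v)); last by ring.
  have := hl y sxy; have := hr y sxy; rewrite -/u -/v => h1 h2.
  have e1 : 3 ^+ kth o y k.+1 = 3 ^+ gap o y k * 3 ^+ kth o y k :> R.
    by rewrite -exprD subnK// kth_leS.
  have e2 : 3 ^+ kth o x k.+1 = 3 ^+ gap o x k * 3 ^+ kth o x k :> R.
    by rewrite -exprD subnK// kth_leS.
  rewrite -(@ler_pM2r _ (3 ^+ kth o x k)) ?exprn_gt0//.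
  apply: (@le_trans _ _ (3 ^+ gap o y k * (3 ^+ kth o y k * (a + b * u)))).
    by rewrite ler_wpM2l// exprn_ge0.
  rewrite mulrA -e1.
  apply: (@le_trans _ _ (3 ^+ kth o x k.+1 * (c + d * v) * (a + b * u))).
    by rewrite ler_wpM2r// addr_ge0// mulr_ge0.
  by rewrite e2 le_eqVlt; apply/orP; left; apply/eqP; ring.
have dis0 (B' : {set 'I_M}) : fintype.disjoint (mem finset.set0) (mem B').
  by rewrite disjoint_subset; apply/fintype.subsetP => i; rewrite inE.
have dA0 : fintype.disjoint (mem A) (mem (finset.set0 : {set 'I_M})).
  by rewrite disjoint_sym.
rewrite step_meanZ !step_meanD !step_meanZ !step_mean_opposite//.
rewrite cards0 !expr0 -[leRHS]mulr1 ler_wpM2l ?exprn_ge0//.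
rewrite le_eqVlt; apply/orP; left; apply/eqP.
transitivity ((a + b * (1 / 2) ^+ #|A|) * (c + d * (1 / 2) ^+ #|B|)).
  by move: ((1 / 2) ^+ #|A|) ((1 / 2) ^+ #|B|) => u v; ring.
by rewrite Aab Bcd mulr1.
Qed.

Definition gap_potential x : R := \sum_(k < M) 3 ^+ gap o x k.+1.

Lemma gap_potential_mean x : off_boundary x ->
  step_mean e x gap_potential <= gap_potential x + 27 * M%:R.
Proof.
move=> hx; rewrite /gap_potential step_mean_sum.
rewrite -[M in 27 * M%:R]card_ord mulr_natr -sumr_const -big_split /=.
by apply: ler_sum => k _; apply: gap_mean_le => //; have := ltn_ord k; lia.
Qed.

Lemma gap_potential_origin : gap_potential [ffun=> o] = M%:R.
Proof.
rewrite /gap_potential (eq_bigr (fun=> 1)) ?sumr_const ?card_ord// => k _.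
by rewrite gap_origin// ltn_ord.
Qed.

End GapPotential.

(** * Sum of the distances between particles *)

(** From [1 - v <= expR (- v)] follows [expR v <= (1 - v)^-1], and [(1 + v + 2 * v ^+ 2) * (1 - v) =
    1 + v ^+ 2 * (1 - 2 * v)] is at least 1. *)
Lemma expR_le_quadratic (R : realType) (v : R) : v <= 1 / 2 ->
  expR v <= 1 + v + 2 * v ^+ 2.
Proof.
move=> v2; have h := expR_ge1Dx (- v); have v1 : 0 < 1 - v by lra.
rewrite -[v in expR v]opprK expRN invf_ple ?posrE ?expR_gt0//; last first.
  by have := sqr_ge0 v; have := sqr_ge0 (v + 1 / 2); rewrite sqrrD; lra.
apply: le_trans h; rewrite invf_ple ?posrE//; last first.
  by have := sqr_ge0 v; have := sqr_ge0 (v + 1 / 2); rewrite sqrrD; lra.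
rewrite -[(1 - v)^-1]mul1r ler_pdivrMr//.
have -> : (1 + v + 2 * v ^+ 2) * (1 - v) = 1 + v ^+ 2 * (1 - 2 * v) by ring.
by rewrite lerDl mulr_ge0 ?sqr_ge0//; lra.
Qed.

Section DistancePotential.
Variables (R : realType) (n M : nat).
Local Notation e := (@path_graph n).
Implicit Types x y : config 'I_n M.

Definition pos x i : R := (x i : nat)%:R.

Definition distance_sum x : R := \sum_i \sum_j `|pos x i - pos x j|.

Definition nb_moving x : R := \sum_i (moving x i)%:R.

Lemma sum_move_prob_pos x i : off_boundary x ->
  \sum_v move_prob e R x i v * (v : nat)%:R = pos x i.
Proof.
move=> hx; have [m|m] := boolP (moving x i); last first.
  by rewrite (sum_move_prob_static e (fun v : 'I_n => (v : nat)%:R) m).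
rewrite (sum_move_prob_moving (fun v => v%:R) (hx i) m) /pos.
have /andP[x0 _] := hx i.
by case: (nat_of_ord (x i)) x0 => // u _; rewrite /= -[u.+2%:R]natr1 -[u.+1%:R]natr1; lra.
Qed.

Lemma step_mean_pos x i : off_boundary x ->
  step_mean e x (fun y => pos y i) = pos x i.
Proof.
by move=> hx; rewrite (step_mean_at i (fun v => (v : nat)%:R) hx) sum_move_prob_pos.
Qed.

Lemma pos_step x y i : step_prob e R x y != 0 ->
  `|pos y i - pos x i| <= (moving x i)%:R.
Proof.
move=> /(path_step_dist i)[h1 h2 _]; rewrite /pos.
by move: h1 h2; rewrite -!(ler_nat R) !natrD ler_norml => h1 h2; lra.
Qed.

(** The difference [u] of the new positions satisfies [|u| <= 2], hence [|u| >= u ^+ 2 / 2]. By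
    independence the mean of the right side is half the sum of two unit variances. *)
Lemma step_mean_collision x i j : off_boundary x -> i != j -> x i = x j ->
  moving x i -> 1 <= step_mean e x (fun y => `|pos y i - pos y j|).
Proof.
move=> hx ij xij m; have mj : moving x j by rewrite /moving -xij.
have xE : pos x j = pos x i by rewrite /pos xij.
pose F (v : nat) : R := v%:R - pos x i.
have sq k : moving x k -> x k = x i ->
    \sum_v move_prob e R x k v * F v ^+ 2 = 1.
  move=> mk xk; rewrite (sum_move_prob_moving (fun v => F v ^+ 2) (hx k) mk) xk /F /pos.
  have /andP[x0 _] := hx i.
  by case: (nat_of_ord (x i)) x0 => // u _; rewrite /= -[u.+2%:R]natr1 -[u.+1%:R]natr1; field.
have mean0 k : pos x k = pos x i -> \sum_v move_prob e R x k v * F v = 0.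
  move=> xk; under eq_bigr do rewrite mulrBr.
  rewrite sumrB sum_move_prob_pos// -mulr_suml move_prob_sum1// mul1r xk.
  exact: subrr.
apply: (@le_trans _ _ (step_mean e x (fun y => 1 / 2 * (F (y i) ^+ 2 + F (y j) ^+ 2
    + -2 * (F (y i) * F (y j)))))).
  rewrite step_meanZ !step_meanD step_meanZ.
  rewrite (step_mean_at i (fun v => F v ^+ 2) hx).
  rewrite (step_mean_at j (fun v => F v ^+ 2) hx).
  rewrite (step_mean_at2 (fun v => F v) (fun v => F v) hx ij).
  by rewrite !sq// !mean0//; lra.
apply: le_step_mean => y sxy.
have := pos_step i sxy; have := pos_step j sxy.
rewrite m mj xE /F -/(pos y i) -/(pos y j) => hj hi.
set u := pos y i - pos y j.
have -> : 1 / 2 * ((pos y i - pos x i) ^+ 2 + (pos y j - pos x i) ^+ 2 +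
   -2 * ((pos y i - pos x i) * (pos y j - pos x i))) = 1 / 2 * (`|u| * `|u|).
  by rewrite -normrM ger0_norm -?expr2 ?sqr_ge0// /u; ring.
have u2 : `|u| <= 2.
  have -> : u = (pos y i - pos x i) - (pos y j - pos x i) by rewrite /u; ring.
  by apply: le_trans (ler_normB _ _) _; rewrite /= in hi hj; lra.
by have := ler_wpM2l (normr_ge0 u) u2; lra.
Qed.

(** Without a collision this is Jensen's inequality: each position is a martingale, and the absolute
    value is bounded below by the linear function with the sign [s] that the difference has before
    the step. *)
Lemma step_mean_distance x i j : off_boundary x ->
  `|pos x i - pos x j| + [&& i != j, x i == x j & moving x i]%:R <=
  step_mean e x (fun y => `|pos y i - pos y j|).
Proof.
move=> hx; case: and3P => [[ij /eqP xij m]|_].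
  by rewrite {1}/pos xij subrr normr0 add0r; exact: step_mean_collision.
rewrite addr0; pose s : R := Num.sg (pos x i - pos x j).
rewrite normrEsg -/s.
have -> : s * (pos x i - pos x j) =
    step_mean e x (fun y => s * (pos y i + -1 * pos y j)).
  by rewrite step_meanZ step_meanD step_meanZ !step_mean_pos// mulN1r.
apply: le_step_mean => y _; rewrite mulN1r.
apply: le_trans (ler_norm _) _; rewrite normrM.
by rewrite ler_piMl// normr_sg; case: eqP.
Qed.

(* Every moving particle shares its vertex with another particle, from which
   it moves away by one on average. *)
Lemma step_mean_distance_sum x : off_boundary x ->
  distance_sum x + nb_moving x <= step_mean e x distance_sum.
Proof.
move=> hx; rewrite /distance_sum step_mean_sum -big_split /=.
apply: ler_sum => i _; rewrite step_mean_sum.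
apply: (@le_trans _ _ (\sum_j (`|pos x i - pos x j| +
    [&& i != j, x i == x j & moving x i]%:R))); last first.
  by apply: ler_sum => j _; exact: step_mean_distance.
rewrite big_split /= lerD2l.
have [m|] := boolP (moving x i); last by move=> _; exact: sumr_ge0.
have [j /andP[ji /eqP xj]] : exists j, (j != i) && (x j == x i).
  move: m; rewrite /moving /occupancy (cardD1 i) !inE eqxx.
  by rewrite add1n ltnS => /card_gt0P[j]; rewrite !inE => h; exists j.
rewrite (bigD1 j)//= eq_sym ji xj eqxx /=.
by rewrite lerDl sumr_ge0.
Qed.

Lemma distance_sum_step x y : step_prob e R x y != 0 ->
  `|distance_sum y - distance_sum x| <= 2 * nb_moving x * M%:R.
Proof.
move=> sxy; rewrite -sumrB.
under eq_bigr do rewrite -sumrB.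
apply: (@le_trans _ _ (\sum_i \sum_j ((moving x i)%:R + (moving x j)%:R))).
  apply: le_trans (ler_norm_sum _ _ _) _; apply: ler_sum => i _.
  apply: le_trans (ler_norm_sum _ _ _) _; apply: ler_sum => j _.
  apply: le_trans (ler_dist_dist _ _) _.
  have -> : pos y i - pos y j - (pos x i - pos x j) =
    (pos y i - pos x i) - (pos y j - pos x j) by ring.
  by apply: le_trans (ler_normB _ _) _; apply: lerD; exact: pos_step.
under eq_bigr do rewrite big_split /= sumr_const card_ord.
rewrite big_split /= sumr_const card_ord sumrMnl -/(nb_moving x) -mulr_natr.
by lra.
Qed.

Lemma nb_moving_le x : nb_moving x <= M%:R.
Proof.
rewrite -[M in M%:R]card_ord -sumr_const; apply: ler_sum => i _.
by rewrite lern1 leq_b1.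
Qed.

Lemma nb_moving_ge1 x : ~~ dispersed x -> 1 <= nb_moving x.
Proof.
move=> /forallPn[v]; rewrite -ltnNge => ov.
have /card_gt0P[i] : (0 < #|[pred i | x i == v]|)%N by exact: ltnW.
rewrite inE => /eqP xi; rewrite /nb_moving (bigD1 i)//= /moving xi ov.
by rewrite lerDl sumr_ge0.
Qed.

(** With [k] moving particles the linear term gains at least [th * k]. The quadratic term is at most
    [8 * th ^+ 2 * k ^+ 2 * M ^+ 2]; as [k <= M], the choice of [th] makes it at most half of that
    gain, and [1 <= k] before dispersion. *)
Lemma step_mean_exp_distance x (th : R) : off_boundary x -> ~~ dispersed x ->
  (0 < M)%N -> th = (16 * M%:R ^+ 3)^-1 ->
  step_mean e x (fun y => expR (- th * distance_sum y)) <=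
  (1 - th / 2) * expR (- th * distance_sum x).
Proof.
move=> hx nd M0 thE.
have m0 : 0 < M%:R :> R by rewrite ltr0n.
have m1 : 1 <= M%:R :> R by rewrite ler1n.
have th0 : 0 < th by rewrite thE invr_gt0 mulr_gt0 ?exprn_gt0.
have thM : th * M%:R ^+ 3 = 1 / 16.
  by rewrite thE; field; rewrite lt0r_neq0.
set k := nb_moving x; have k1 : 1 <= k := nb_moving_ge1 nd.
have kM : k <= M%:R := nb_moving_le x.
set E := expR (- th * distance_sum x).
have E0 : 0 <= E by exact: expR_ge0.
have thkM : th * (k * M%:R ^+ 2) <= 1 / 16.
  rewrite -thM ler_pM2l// exprS ler_wpM2r// exprn_ge0//; lra.
(* This upper bound is affine in [distance_sum y], so that only the mean of the latter enters
   afterwards. *)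
apply: (@le_trans _ _ (step_mean e x (fun y => E * (1 - th * distance_sum x * -1
    + 8 * th ^+ 2 * k ^+ 2 * M%:R ^+ 2 + - th * distance_sum y)))).
  apply: le_step_mean => y sxy; have := distance_sum_step sxy; rewrite -/k.
  set D := distance_sum y - distance_sum x => hD.
  have -> : expR (- th * distance_sum y) = E * expR (- th * D).
    by rewrite -expRD; congr expR; rewrite /D; ring.
  rewrite ler_wpM2l//.
  have hv : `|- th * D| <= 1 / 8.
    rewrite normrM normrN (gtr0_norm th0).
    apply: le_trans (ler_wpM2l (ltW th0) hD) _.
    have : th * (k * M%:R) <= th * (k * M%:R ^+ 2).
      rewrite ler_pM2l// ler_pM2l; last by lra.
      by rewrite expr2 ler_peMl// ltW.
    by lra.
  have hv2 : - th * D <= 1 / 2 by have := ler_norm (- th * D); lra.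
  apply: le_trans (expR_le_quadratic hv2) _.
  have hs : D ^+ 2 <= (2 * k * M%:R) ^+ 2.
    by rewrite -real_normK ?num_real// lerXn2r// nnegrE ?mulr_ge0//; lra.
  have := ler_wpM2l (sqr_ge0 th) hs; rewrite /D.
  set u := distance_sum y; set v := distance_sum x => hh.
  rewrite [X in X <= _](_ : _ = 1 - th * v * -1 - th * u
    + 2 * (th ^+ 2 * (u - v) ^+ 2)); last by ring.
  rewrite [X in _ <= X](_ : _ = 1 - th * v * -1 - th * u
    + 2 * (th ^+ 2 * (2 * k * M%:R) ^+ 2)); last by ring.
  lra.
rewrite step_meanZ step_meanD step_mean1// step_meanZ [leRHS]mulrC ler_wpM2l//.
have := step_mean_distance_sum hx; rewrite -/k => /(ler_wpM2l (ltW th0)) h.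
have h2 : 8 * th ^+ 2 * k ^+ 2 * M%:R ^+ 2 <= th * k / 2.
  rewrite [leLHS](_ : _ = 8 * (th * k) * (th * (k * M%:R ^+ 2))); last by ring.
  have : 0 <= th * k by rewrite mulr_ge0; lra.
  by move/ler_wpM2l => /(_ _ _ thkM); lra.
have h3 : th <= th * k by rewrite ler_peMr// ltW.
by lra.
Qed.

End DistancePotential.

(** * Configurations without large gaps *)

Section PathDistance.
Variable n : nat.
Local Notation e := (@path_graph n).

Lemma path_graph_walk_ge (u : 'I_n) p : path e u p ->
  ((last u p - u) + (u - last u p) <= size p)%N.
Proof.
elim: p u => [|w p IHp] u /=; first by rewrite subnn.
rewrite {1}/path_graph => /andP[uw /IHp].
by move: (nat_of_ord (last w p)) (nat_of_ord u) (nat_of_ord w) uw => a b c; lia.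
Qed.

Lemma path_graph_walk k (u v : 'I_n) : ((v - u) + (u - v) = k)%N ->
  exists p : k.-tuple 'I_n, path e u p && (last u p == v).
Proof.
elim: k u => [|k IHk] u uv.
  by exists [tuple] => /=; apply/eqP/val_inj => /=; lia.
have [w uw wv] : exists2 w, e u w & ((v - w) + (w - v) = k)%N.
  have [uv'|uv'] := ltnP u v.
    have h : (u.+1 < n)%N := leq_ltn_trans uv' (ltn_ord v).
    by exists (Ordinal h); rewrite /path_graph /= ?eqxx//; lia.
  have h : (u.-1 < n)%N := leq_ltn_trans (leq_pred u) (ltn_ord u).
  by exists (Ordinal h); rewrite /path_graph /=; lia.
have [p /andP[pp pv]] := IHk w wv.
by exists [tuple of w :: p]; rewrite /= uw pp.
Qed.

(** With truncated subtraction, the right side is the absolute difference of the two positions. *)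
Lemma gdist_path (u v : 'I_n) : gdist e u v = ((v - u) + (u - v))%N.
Proof.
set k := ((v - u) + (u - v))%N; rewrite /gdist; set a := (X in find X).
have nk : (k < n)%N.
  by rewrite /k; have := ltn_ord u; have := ltn_ord v; lia.
have ak : a k by have [p hp] := path_graph_walk (erefl k); apply/existsP; exists p.
apply/eqP; rewrite eqn_leq; apply/andP; split.
  rewrite leqNgt; apply/negP => lt; have := before_find 0%N lt.
  by rewrite nth_iota ?card_ord// ak.
have hs : has a (iota 0 #|'I_n|).
  by apply/hasP; exists k => //; rewrite mem_iota card_ord.
have := nth_find 0%N hs; rewrite nth_iota ?add0n; last first.
  by rewrite -[X in (_ < X)%N](size_iota 0) -has_find.
move=> /existsP[p /andP[/path_graph_walk_ge + /eqP lp]].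
by rewrite lp size_tuple.
Qed.

(** Pigeonhole principle: the particles occupy distinct vertices among the at most [2 * D + 1]
    within distance [D] of the origin, which [f] numbers from the left. *)
Lemma dispersed_half_le M (o : 'I_n) (x : config 'I_n M) D : dispersed x ->
  (forall i, gdist e o (x i) <= D)%N -> (M./2 <= D)%N.
Proof.
move=> /forallP dx hD; suff : (M <= D.*2.+1)%N by lia.
rewrite -[M in (M <= _)%N]card_ord -[D.*2.+1]card_ord.
pose f i : 'I_D.*2.+1 := inord (x i + D - o).
apply: (@leq_card _ _ f) => i j fij.
have xij : x i = x j.
  apply/val_inj => /=; move: (congr1 val fij) (hD i) (hD j).
  rewrite /f !gdist_path /=.
  move: (nat_of_ord (x i)) (nat_of_ord (x j)) (nat_of_ord o) => a b c.
  by move=> + ha hb; rewrite !inordK; lia.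
apply/eqP; apply: contraLR (dx (x i)) => ij.
rewrite -ltnNge /occupancy (cardD1 i) !inE eqxx add1n ltnS.
by apply/card_gt0P; exists j; rewrite !inE eq_sym ij xij eqxx.
Qed.

End PathDistance.

(** * Consequences of small gaps for distances and potentials *)

Section GoodConfigurations.
Variables (R : realType) (n M : nat) (o : 'I_n) (a : R).
Implicit Types x y : config 'I_n M.

(** The parameter [a] stands for [ln M]. *)
Definition small_gaps x := [forall k : 'I_M, (gap o x k.+1)%:R <= 4 * a].

Lemma small_gaps_site x i j : small_gaps x ->
  (site o x j)%:R - (site o x i)%:R <= 4 * a * M%:R.
Proof.
move=> /forallP h.
have : (site o x j <= site o x i + \sum_(k < M) gap o x k.+1)%N.
  by have := site_sub_le o x i j; lia.
rewrite -(ler_nat R) natrD natr_sum => h1.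
have : \sum_(k < M) (gap o x k.+1)%:R <= \sum_(k < M) 4 * a.
  by apply: ler_sum => k _; exact: h.
by rewrite sumr_const card_ord -mulr_natr; lra.
Qed.

Lemma small_gaps_gdist x i : small_gaps x ->
  (gdist (@path_graph n) o (x i))%:R <= 4 * a * M%:R.
Proof.
move=> sg; have := small_gaps_site None (Some i) sg.
have := small_gaps_site (Some i) None sg; rewrite gdist_path /=.
have [h|/ltnW h] := leqP o (x i).
  by move: (h); rewrite -subn_eq0 => /eqP ->; rewrite addn0 natrB.
by move: (h); rewrite -subn_eq0 => /eqP ->; rewrite add0n natrB.
Qed.

(** Particles are within [4 * a * M] of the origin, while each end of the path is at distance at
    least [(n - 2) / 2 >= 6 * a * M - 1 / 2] from it; [1 <= a * M] absorbs the rounding. *)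
Lemma small_gaps_off_boundary x : 1 <= a * M%:R -> central o ->
  12 * M%:R * a <= n.-1%:R -> small_gaps x -> off_boundary x.
Proof.
move=> aM co hn sg i.
have h1 := small_gaps_site None (Some i) sg.
have h2 := small_gaps_site (Some i) None sg.
have [c1 c2] : (n <= o.*2.+2)%N /\ (o.*2 <= n)%N.
  by move: co; rewrite /central => /orP[]/eqP ->; lia.
rewrite /= in h1 h2.
have n0 : (0 < n)%N := leq_ltn_trans (leq0n o) (ltn_ord o).
rewrite -subn1 natrB// in hn.
rewrite -(ler_nat R) -addnn -!natr1 natrD in c1.
rewrite -(ler_nat R) -addnn natrD in c2.
apply/andP; split; first by rewrite -(ltr_nat R); lra.
by rewrite -(ltr_nat R) -subn1 natrB//; lra.
Qed.

Lemma small_gaps_distance_sum x : small_gaps x ->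
  distance_sum R x <= 4 * a * M%:R ^+ 3.
Proof.
move=> sg.
apply: (@le_trans _ _ (\sum_(i < M) \sum_(j < M) (4 * a * M%:R))).
  apply: ler_sum => i _; apply: ler_sum => j _.
  have := small_gaps_site (Some i) (Some j) sg.
  have := small_gaps_site (Some j) (Some i) sg.
  by rewrite /= /pos ler_norml => h1 h2; apply/andP; split; lra.
rewrite !sumr_const card_ord -[leLHS]mulr_natr -mulr_natr.
by rewrite le_eqVlt; apply/orP; left; apply/eqP; ring.
Qed.

(** The summand of one large gap suffices; the left side is [3 ^ (4 * a)] with a real exponent. *)
Lemma large_gap_potential x : 0 <= a -> ~~ small_gaps x ->
  expR (ln 3 * (4 * a)) <= gap_potential R o x.
Proof.
move=> a0 /forallPn[k]; rewrite -ltNge => hk.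
rewrite /gap_potential (bigD1 k)//=.
apply: (@le_trans _ _ (3 ^+ gap o x k.+1)); last first.
  by rewrite lerDl sumr_ge0// => ? _; exact: exprn_ge0.
rewrite -[3 in leRHS]lnK ?posrE// -expRM_natr ler_expR ler_wpM2l ?ln_ge0 ?ler1n//.
exact: ltW.
Qed.

End GoodConfigurations.

(** * Numerical estimate of the failure probability *)

Lemma ln3_gt1 (R : realType) : 1 < ln 3 :> R.
Proof.
rewrite -ltr_expR lnK ?posrE//.
(* From [expR (- 1 / 6) >= 5 / 6] one gets [e <= (6 / 5) ^+ 6 = 2.985984], just below 3. *)
have -> : expR 1 = expR (1 / 6) ^+ 6 :> R.
  by rewrite -expRM_natr; congr expR; lra.
have h : expR (1 / 6) <= 6 / 5 :> R.
  have := @expR_ge1Dx R (- (1 / 6)); rewrite expRN => h.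
  have e0 := @expR_gt0 R (1 / 6).
  by move: h; rewrite -[(expR _)^-1]mul1r ler_pdivlMr//; lra.
apply: le_lt_trans (lerXn2r 6 _ _ h) _; rewrite ?nnegrE ?expR_ge0//.
by rewrite !exprS expr0; lra.
Qed.

(* With [a = ln M], the first term bounds the probability that some gap ever
   exceeds [4 * a], the second one the probability of not being dispersed after
   [m] steps. *)
Lemma failure_bound (R : realType) (delta : R) : 0 < delta ->
  exists A : R, forall (M : nat) (a : R) (m : nat), a = ln M%:R -> A <= a ->
    m%:R <= 64 * M%:R ^+ 3 * a < m%:R + 1 ->
    [/\ 1 <= a, (0 < M)%N &
    (M%:R + 27 * M%:R * m%:R) / expR (ln 3 * (4 * a)) +
    (1 - (16 * M%:R ^+ 3)^-1 / 2) ^+ m * 1 /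
      expR (- (16 * M%:R ^+ 3)^-1 * (4 * a * M%:R ^+ 3)) <= delta].
Proof.
(* [eta] is the excess of the exponent: [3 ^ (4 * a)] equals [M ^+ 4 * expR (eta * a)]. The
   numerator has order [M ^+ 4 * a], with constant [K], so any positive excess is enough. *)
move=> d0; pose eta : R := 4 * ln 3 - 4.
have eta0 : 0 < eta by rewrite /eta; have := ln3_gt1 R; lra.
have [K KE] : exists K : R, K = 27 * 64 + 1 by eexists.
have K0 : 0 < K by rewrite KE; lra.
pose B : R := 4 * K / eta ^+ 2 + 1.
have B0 : 0 < B.
  by rewrite addr_gt0 ?ltr01 ?divr_gt0 ?exprn_gt0 ?mulr_gt0.
(* The two failure terms add up to at most [B / a]. The bound [2 <= a] also rules out [M = 0], for
   which [ln] takes the value 0. *)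
exists (Num.max 2 (B / delta)) => M a m aE; rewrite ge_max => /andP[a2 aB] /andP[m1 m2].
have M0 : (0 < M)%N.
  by case: M aE {m1 m2} => // aE; move: a2; rewrite aE ln0//; lra.
split=> //; first by lra.
have Mgt0 : 0 < M%:R :> R by rewrite ltr0n.
have Mge1 : 1 <= M%:R :> R by rewrite ler1n.
have ME : M%:R ^+ 4 = expR (4 * a) :> R.
  by rewrite mulrC expRM_natr aE lnK ?posrE.
have a0 : 0 < a by lra.
have M31 : 1 <= M%:R ^+ 3 :> R by rewrite exprn_ege1.
have M30 : 0 < M%:R ^+ 3 :> R by lra.
have M14 : M%:R <= M%:R ^+ 4 :> R by rewrite exprS ler_peMr// ltW.
have first_le : (M%:R + 27 * M%:R * m%:R) / expR (ln 3 * (4 * a)) <=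
    4 * K / eta ^+ 2 / a.
  rewrite ler_pdivrMr ?expR_gt0//.
  have -> : expR (ln 3 * (4 * a)) = expR (eta * a / 2) ^+ 2 * M%:R ^+ 4.
    by rewrite ME -expRM_natr -expRD; congr expR; rewrite /eta; lra.
  have h1 : M%:R + 27 * M%:R * m%:R <= K * (M%:R ^+ 4 * a).
    have : M%:R * m%:R <= 64 * (M%:R ^+ 4 * a).
      have := ler_wpM2l (ltW Mgt0) m1; rewrite [M%:R ^+ 4]exprS; lra.
    have : M%:R ^+ 4 <= M%:R ^+ 4 * a by rewrite ler_peMr ?exprn_ge0//; lra.
    by rewrite KE; lra.
  apply: le_trans h1 _; rewrite [_ ^+ 4 * a]mulrC mulrA [leRHS]mulrA.
  rewrite ler_wpM2r ?exprn_ge0//.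
  (* Squaring [u <= expR u] yields a factor [a ^+ 2], one power of which cancels the [a] of the
     numerator. *)
  have h2 : (eta * a / 2) ^+ 2 <= expR (eta * a / 2) ^+ 2.
    have u0 : 0 <= eta * a / 2 by rewrite divr_ge0// mulr_ge0// ltW.
    rewrite lerXn2r// ?nnegrE ?expR_ge0//.
    by have := expR_ge1Dx (eta * a / 2); lra.
  apply: (@le_trans _ _ (4 * K / eta ^+ 2 / a * (eta * a / 2) ^+ 2)).
    rewrite le_eqVlt; apply/orP; left; apply/eqP; field.
    by rewrite !lt0r_neq0.
  apply: ler_wpM2l h2; apply: ltW.
  by rewrite divr_gt0 ?divr_gt0 ?exprn_gt0 ?mulr_gt0.
set th := (16 * M%:R ^+ 3)^-1.
have thE : th * M%:R ^+ 3 = 1 / 16 by rewrite /th; field; rewrite lt0r_neq0.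
have th0 : 0 < th by rewrite invr_gt0 mulr_gt0.
have th1 : th <= 1 / 16 by rewrite -thE ler_peMr// ltW.
have second_le : (1 - th / 2) ^+ m * 1 / expR (- th * (4 * a * M%:R ^+ 3)) <= 1 / a.
  have -> : - th * (4 * a * M%:R ^+ 3) = - (a / 4).
    transitivity (- (4 * a * (th * M%:R ^+ 3))); first by ring.
    by rewrite thE; field.
  rewrite expRN invrK mulr1.
  have h1 : (1 - th / 2) ^+ m <= expR (- (th / 2) * m%:R).
    rewrite expRM_natr lerXn2r// ?nnegrE ?expR_ge0//; first by lra.
    exact: expR_ge1Dx.
  apply: le_trans (ler_wpM2r (expR_ge0 _) h1) _; rewrite -expRD.
  (* The constant 64 makes the decay over [m] steps [2 * a], up to [th / 2] lost by rounding [m]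
     down; the largest possible distance sum costs only [a / 4]. *)
  have h2 : - (th / 2) * m%:R + a / 4 <= - a.
    have : th / 2 * (64 * M%:R ^+ 3 * a) <= th / 2 * (m%:R + 1).
      by rewrite ler_wpM2l// ?divr_ge0 ?ltW.
    have -> : th / 2 * (64 * M%:R ^+ 3 * a) = 32 * a * (th * M%:R ^+ 3) by field.
    by rewrite thE; lra.
  apply: (@le_trans _ _ (expR (- a))); first by rewrite ler_expR.
  rewrite expRN -[(expR a)^-1]mul1r ler_pM2l// lef_pV2 ?posrE ?expR_gt0//.
  by have := expR_ge1Dx a; lra.
apply: le_trans (lerD first_le second_le) _.
rewrite -mulrDl -/B ler_pdivrMr// mulrC -ler_pdivrMr//.
Qed.

(** * Termination time and measurability *)

Section Termination.
Variables (R : realType) (V : finType) (e : rel V) (M : nat) (o : V).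

Lemma T_Disp_eq_some (z : nat -> config V M) t : dispersed (z t) ->
  (forall s, (s < t)%N -> ~~ dispersed (z s)) -> T_Disp z = Some t.
Proof.
move=> dt ndt; rewrite /T_Disp; case: pselect => [h|[]]; last by exists t.
congr Some; case: ex_minnP => m dm mle; apply/eqP; rewrite eqn_leq mle//=.
by rewrite leqNgt; apply/negP => /ndt; rewrite dm.
Qed.

Lemma T_Disp_some (z : nat -> config V M) t : T_Disp z = Some t ->
  dispersed (z t) /\ (forall s, (s < t)%N -> ~~ dispersed (z s)).
Proof.
rewrite /T_Disp; case: pselect => // h [<-]; case: ex_minnP => m dm mle.
by split=> // s sm; apply/negP => /mle; rewrite leqNgt sm.
Qed.

(** The event is a countable union over the termination time [T] of events determined by the
    configurations up to time [T]. *)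
Lemma measurable_disp (d : measure_display) (Omega : measurableType d)
    (X : nat -> Omega -> config V M) (Q : nat -> nat -> Prop) :
  (forall t x, measurable [set w | X t w = x]) ->
  measurable [set w | exists T D : nat,
    [/\ T_Disp (X^~ w) = Some T, D_Disp e o (X^~ w) = Some D & Q T D]].
Proof.
move=> mX; pose D (x : config V M) := \max_(i < M) gdist e o (x i).
rewrite (_ : [set w | _] = \bigcup_T
  ([set w | (dispersed (X T w) && `[< Q T (D (X T w)) >])] `&`
   \bigcap_(s in [set s | (s < T)%N]) [set w | ~~ dispersed (X s w)])).
  apply: bigcupT_measurable => T; apply: measurableI.
    exact: (measurable_at mX T [pred x | dispersed x && `[< Q T (D x) >]]).
  apply: bigcap_measurableType => s _.
  exact: (measurable_at mX s [pred x | ~~ dispersed x]).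
apply/seteqP; split => w /=.
  move=> [T [D' [TE]]]; rewrite /D_Disp TE /= => -[<-] q.
  have [dT nd] := T_Disp_some TE.
  by exists T => //; split=> //=; rewrite dT; exact/asboolP.
move=> [T _ [/andP[dT /asboolP q] nd]]; exists T, (D (X T w)).
have TE := T_Disp_eq_some dT nd.
by split=> //; rewrite /D_Disp TE.
Qed.

End Termination.

(** * The two potentials combined through the exit bound *)

Theorem theorem4 (R : realType) :
  exists2 C : R, 0 < C &
  forall eps delta : R, 0 < eps -> 0 < delta ->
  \forall M \near \oo,
  forall (n : nat) (o : 'I_n)
    (d : measure_display) (Omega : measurableType d) (P : probability Omega R)
    (X : nat -> Omega -> config 'I_n M),
  12 * M%:R * ln (M%:R : R) <= n.-1%:R ->
  central o ->
  dispersion_process (@path_graph n) o P X ->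
  ((1 - delta)%:E <=
   P [set w | exists T D : nat,
       [/\ T_Disp (X^~ w) = Some T,
           D_Disp (@path_graph n) o (X^~ w) = Some D,
           (M./2 <= D)%N,
           (D%:R <= 4 * (1 + eps) * M%:R * ln (M%:R : R))%R
         & (T%:R <= C * M%:R ^+ 3 * ln (M%:R : R))%R]])%E.
Proof.
exists 64 => // eps delta eps0 delta0.
have [A hA] := failure_bound delta0.
near=> M => n o d Omega P X hn co [mX P0 stepX].
pose a : R := ln M%:R; pose m := Num.truncn (64 * M%:R ^+ 3 * a).
have Aa : A <= a.
  rewrite -ler_expR /a lnK; first by near: M; exact: nbhs_infty_ger.
  rewrite posrE ltr0n; near: M; exists 1%N => //.
have M1 : 1 <= M%:R :> R by rewrite ler1n; near: M; exists 1%N.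
have x0 : 0 <= 64 * M%:R ^+ 3 * a by rewrite !mulr_ge0 ?exprn_ge0 ?ln_ge0.
have mitv : m%:R <= 64 * M%:R ^+ 3 * a < m%:R + 1.
  by rewrite natr1; exact: truncn_itv.
have [a1 M0 fail] := hA M a m erefl Aa mitv.
pose th : R := (16 * M%:R ^+ 3)^-1.
have th0 : 0 < th by rewrite invr_gt0 mulr_gt0// exprn_gt0// ltr0n.
have th1 : th <= 1.
  rewrite invf_le1 ?mulr_gt0// ?exprn_gt0 ?ltr0n//.
  by rewrite -[leLHS]mulr1 ler_pM ?exprn_ege1 ?ler1n.
have aM : 1 <= a * M%:R by rewrite -[leLHS]mulr1 ler_pM.
have init0 : distance_sum R ([ffun=> o] : config 'I_n M) = 0.
  by rewrite /distance_sum big1// => i _; rewrite big1// => j _;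
    rewrite /pos !ffunE subrr normr0.
(* With large gaps as [bad], a good exit from [S] is a first dispersed configuration whose gaps,
   like all earlier ones, are small; its time is therefore the termination time. *)
pose S (x : config 'I_n M) := ~~ dispersed x && small_gaps o a x.
have S_int (x : config 'I_n M) : small_gaps o a x -> off_boundary x.
  exact: (small_gaps_off_boundary aM co hn).
have hit := @markov_exit R d Omega P _ X mX S (fun x => ~~ small_gaps o a x)
  (step_prob (@path_graph n) R) stepX
  (gap_potential R o) (fun x => expR (- th * distance_sum R x))
  (27 * M%:R) (1 - th / 2) (expR (ln 3 * (4 * a)))
  (expR (- th * (4 * a * M%:R ^+ 3))).
apply: le_trans (hit _ _ _ _ _ _ _ _ _ _ _ [ffun=> o] m _ _ P0 _).
- rewrite lee_fin lerB// gap_potential_origin init0 mulr0 expR0.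
  exact: fail.
- by move=> x; apply: sumr_ge0 => k _; exact: exprn_ge0.
- by move=> x; exact: expR_ge0.
- exact: mulr_ge0.
- by rewrite subr_ge0 ler_pdivrMr// mul1r (le_trans th1)// ler1n.
- exact: expR_gt0.
- exact: expR_gt0.
- by move=> x; apply: large_gap_potential; exact: le_trans a1.
- move=> x /andP[_ sg]; rewrite ler_expR !mulNr lerN2 ler_pM2l//.
  by have := small_gaps_distance_sum sg.
- move=> x /andP[_ /S_int hx]; have := @step_mean1 R n M x 1 hx.
  by rewrite /step_mean => <-; apply: ler_sum => y _; rewrite mulr1.
- by move=> x /andP[_ /S_int hx]; exact: gap_potential_mean.
- by move=> x /andP[nd /S_int hx]; exact: step_mean_exp_distance.
- rewrite (_ : [set w | _] = [set w | exists T D : nat,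
    [/\ T_Disp (X^~ w) = Some T, D_Disp (@path_graph n) o (X^~ w) = Some D &
      [/\ (M./2 <= D)%N, D%:R <= 4 * (1 + eps) * M%:R * ln (M%:R : R)
        & T%:R <= 64 * M%:R ^+ 3 * ln (M%:R : R)]]]).
    exact: measurable_disp.
  apply/seteqP; split => w /= [T [D]]; first by case=> *; exists T, D.
  by case=> ? ? [? ? ?]; exists T, D.
- move=> w t tm Slt; rewrite /S negb_and negbK => + /negPn sg.
  rewrite sg orbF => dt.
  have TE : T_Disp (X^~ w) = Some t.
    by apply: T_Disp_eq_some => // s /Slt /andP[].
  exists t, (\max_(i < M) gdist (@path_graph n) o (X t w i)); split=> //.
  + by rewrite /D_Disp TE.
  + by apply: (dispersed_half_le dt) => i; exact: (bigop.leq_bigmax i).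
  + have [|i ->] := @bigop.eq_bigmax 'I_M (fun i => gdist (@path_graph n) o (X t w i)).
      by rewrite card_ord.
    apply: le_trans (small_gaps_gdist i sg) _; rewrite -/a.
    rewrite mulrAC ler_wpM2r ?ler_wpM2r ?ler0n ?ler_peMr//.
      exact: le_trans a1.
    by rewrite lerDl ltW.
  + by case/andP: mitv => m1 _; apply: le_trans m1; rewrite ler_nat.
Unshelve. all: by end_near. Qed.
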